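(* Let $B$ be a Borel relation on $2^\omega$ such that $s(B)=s(\mathbb{T}_0)$. Then $(2^\omega,A)\sqsubseteq_c(2^\omega,B)$ for some $A\in\{G_{s(\mathbb{G}_0)},\mathbb{T}_0,\mathbb{U}_0,s(\mathbb{T}_0)\}$.
   Context: $s(E):=E\cup E^{-1}$. $(X,A)\sqsubseteq_c(Y,C)$ means there is an injective continuous $f:X\to Y$ with $(f(x),f(y))\in C\iff(x,y)\in A$. Let $\psi:\omega\to2^{<\omega}$ list finite binary sequences by increasing length and lexicographically within each length, $s_n:=\psi(n)0^{n-|\psi(n)|}$, $\mathbb{G}_0:=\{(s_n0\gamma,s_n1\gamma)\mid n\in\omega,\gamma\in2^\omega\}$, $G_{s(\mathbb{G}_0)}:=\{(0\alpha,1\beta)\mid(\alpha,\beta)\in s(\mathbb{G}_0)\}$, $\mathbb{T}_0:=\{(\varepsilon\alpha,(1-\varepsilon)\beta)\mid\varepsilon\in2,(\alpha,\beta)\in\mathbb{G}_0\}$, $\mathbb{U}_0:=G_{s(\mathbb{G}_0)}\cup\mathbb{T}_0$. *)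

(* Defs.v *)
From mathcomp Require Import all_boot.
From mathcomp Require Import boolp classical_sets topology cantor.
From mathcomp Require Import measurable_structure.

Set Implicit Arguments.
Unset Strict Implicit.
Unset Printing Implicit Defensive.

Local Open Scope classical_set_scope.
Local Open Scope relation_scope.

Definition symmetrization (X : Type) (E : set (X * X)) : set (X * X) :=
  E `|` E^-1.

Definition borel (T : topologicalType) (B : set T) : Prop := <<s open >> B.

Definition cont_reducible (X Y : topologicalType)
    (A : set (X * X)) (C : set (Y * Y)) : Prop :=
  exists f : X -> Y,
    [/\ injective f, continuous f & forall x y, C (f x, f y) <-> A (x, y)].

(* The words of length [k], in lexicographic order ([false] is 0, [true] is 1). *)
Fixpoint words (k : nat) : seq (seq bool) :=
  if k is k'.+1 then map (cons false) (words k') ++ map (cons true) (words k')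
  else [:: [::]].

(* There are [2 ^ n.+1 - 1 > n] words of length at most [n], so the default
   value of [nth] is never reached. *)
Definition psi (n : nat) : seq bool :=
  nth [::] (flatten [seq words k | k <- iota 0 n.+1]) n.

Definition s_ (n : nat) : seq bool :=
  psi n ++ nseq (n - size (psi n)) false.

(* The concatenation of a finite word and an infinite one: the default value
   of [nth] is used exactly from position [size u] on. *)
Definition wcat (u : seq bool) (x : cantor_space) : cantor_space :=
  fun i => nth (x (i - size u)) u i.

Definition G0 : set (cantor_space * cantor_space) :=
  [set p | exists n (x : cantor_space),
     p = (wcat (rcons (s_ n) false) x, wcat (rcons (s_ n) true) x)].

Definition G_s_G0 : set (cantor_space * cantor_space) :=
  [set p | exists x y, symmetrization G0 (x, y) /\
     p = (wcat [:: false] x, wcat [:: true] y)].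

Definition T0 : set (cantor_space * cantor_space) :=
  [set p | exists e x y, G0 (x, y) /\ p = (wcat [:: e] x, wcat [:: ~~ e] y)].

Definition U0 : set (cantor_space * cantor_space) := G_s_G0 `|` T0.

(* Main.v *)
Require Import Defs.
From mathcomp Require Import all_boot.
From mathcomp Require Import boolp classical_sets topology cantor.
From mathcomp Require Import functions measurable_structure.

(* Since [s(B) = s(T0)], the relation [B] is determined by the colour it gives
   to each edge [(x, y)] of [G0]: which of the four pairs (0x,1y), (1y,0x),
   (1x,0y), (0y,1x) belong to [B]. The colourings have the Baire property, so
   there are a colour [c] and a word [t] such that, for densely many [s_ m]
   extending [t], the edges based at [s_ m] have colour [c] generically in some
   cylinder. A fusion argument then yields a continuous injective map of the form
     x |-> t p_0 x_0 q_0 p_1 x_1 q_1 p_2 x_2 q_2 ...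
   reducing [G0] to [G0], all of whose image edges have colour [c]; writing
   1 - x_i in place of x_i reduces [G0^-1] to [G0] instead. Reversing [G0] or
   exchanging the two copies of the Cantor space turns each of the nine
   possible colours into that of one of the four relations. *)

Set Implicit Arguments.
Unset Strict Implicit.
Unset Printing Implicit Defensive.

Local Open Scope classical_set_scope.

Implicit Types (x y z : cantor_space) (u v w : seq bool).

(** * Baire category in the Cantor space *)

Definition cyl w : set cantor_space := [set y | mkseq y (size w) = w].

Definition shift (k : nat) x : cantor_space := fun i => x (k + i).

Lemma mkseq_eqP x y n :
  mkseq x n = mkseq y n <-> forall j, j < n -> x j = y j.
Proof.
split=> [e j jn|h]; first by rewrite -(nth_mkseq false x jn) e nth_mkseq.
by apply: (@eq_from_nth _ false); rewrite !size_mkseq // => i i_n;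
   rewrite !nth_mkseq ?h.
Qed.

Lemma cylP w y : cyl w y <-> forall j, j < size w -> y j = nth false w j.
Proof.
split=> [e j jn|h]; first by rewrite -[w in RHS]e nth_mkseq.
by apply: (@eq_from_nth _ false); rewrite ?size_mkseq // => i i_n;
   rewrite nth_mkseq ?h.
Qed.

Lemma wcat_lt w z j : j < size w -> wcat w z j = nth false w j.
Proof. by move=> jw; rewrite /wcat (set_nth_default false). Qed.

Lemma wcat_ge w z j : wcat w z (size w + j) = z j.
Proof. by rewrite /wcat nth_default ?leq_addr// addKn. Qed.

Lemma shift_wcat w z : shift (size w) (wcat w z) = z.
Proof. by apply/funext => j; rewrite /shift wcat_ge. Qed.

Lemma cyl_wcat w z : cyl w (wcat w z).
Proof. by apply/cylP => j jw; rewrite wcat_lt. Qed.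

Lemma wcat_shift w y : cyl w y -> wcat w (shift (size w) y) = y.
Proof.
move=> /cylP h; apply/funext => j; case: (ltnP j (size w)) => jw.
  by rewrite wcat_lt ?h.
by rewrite -(subnKC jw) wcat_ge.
Qed.

Lemma cyl_cat u v y : cyl (u ++ v) y <-> cyl u y /\ cyl v (shift (size u) y).
Proof.
split=> [/cylP h|[/cylP hu /cylP hv]].
  split; apply/cylP => j jn.
    by rewrite h ?nth_cat ?jn// size_cat ltn_addr.
  by rewrite /shift h ?size_cat ?ltn_add2l// nth_cat ltnNge leq_addr/= addKn.
apply/cylP => j; rewrite size_cat nth_cat => jn.
case: (ltnP j (size u)) => ju; first exact: hu.
by rewrite -hv ?ltn_subLR// /shift subnKC.
Qed.

Lemma cyl_catl u v : cyl (u ++ v) `<=` cyl u.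
Proof. by move=> y /cyl_cat[]. Qed.

Lemma wcat_cons d w z : wcat (d :: w) z = wcat [:: d] (wcat w z).
Proof.
by apply/funext => -[|i] //; rewrite /wcat /= subSS subn1 nth_nil.
Qed.

Lemma cvg_cantor (F : set_system cantor_space) (FF : Filter F) y :
  (forall i, F [set z | z i = y i]) -> F --> y.
Proof.
move=> h; apply/cvg_sup => i U [V [[W oW <-] Wy] VU].
by apply: filterS (h i) => z /= zy; apply: VU => /=; rewrite /= zy.
Qed.

Lemma nbhs_mkseq x n : nbhs x [set z | mkseq z n = mkseq x n].
Proof.
elim: n => [|n IH]; first by apply: filterS filterT => z.
have xn : nbhs x [set z : cantor_space | z n = x n].
  have := @proj_continuous nat (fun=> bool) n x.
  by move=> /(_ [set x n]); apply; exact: discrete_set1.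
by apply: filterS2 IH xn => z /mkseq_eqP e1 e2; apply/mkseq_eqP => j;
   rewrite ltnS leq_eqVlt => /predU1P[->|/e1].
Qed.

(** The filter generated by the cylinders around [x] converges to [x] coordinatewise, so it contains
    [U]. *)
Lemma open_cyl (U : set cantor_space) x : open U -> U x ->
  exists n, [set z | mkseq z n = mkseq x n] `<=` U.
Proof.
move=> oU Ux.
pose F := filter_from setT (fun n => [set z | mkseq z n = mkseq x n]).
have FF : Filter F.
  apply: filter_from_filter; first by exists 0.
  move=> i j _ _; exists (maxn i j) => // z /= /mkseq_eqP h.
  by split; apply/mkseq_eqP => k kn; apply: h; rewrite leq_max kn ?orbT.
have Fx : F --> x.
  by apply: cvg_cantor => i; exists i.+1 => // z /mkseq_eqP; apply.
have [n _ nU] : F U by apply: Fx; exact: open_nbhs_nbhs.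
by exists n.
Qed.

Lemma continuous_cantor (f : cantor_space -> cantor_space) :
  (forall x i, exists n, forall z, mkseq z n = mkseq x n -> f z i = f x i) ->
  continuous f.
Proof.
move=> h x; apply: cvg_cantor => i; have [n hn] := h x i.
by apply: filterS (nbhs_mkseq x n).
Qed.

Lemma continuous_wcat w : continuous (wcat w).
Proof.
apply: continuous_cantor => x i; exists i.+1 => z /mkseq_eqP h.
by rewrite /wcat h// ltnS leq_subr.
Qed.

Definition nowhere_dense (F : set cantor_space) :=
  forall v, exists v', cyl (v ++ v') `&` F = set0.

Definition meager (M : set cantor_space) :=
  exists2 F : nat -> set cantor_space,
    forall n, nowhere_dense (F n) & M `<=` \bigcup_n F n.

Lemma sub_meager (M N : set cantor_space) : M `<=` N -> meager N -> meager M.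
Proof. by move=> MN [F hF NF]; exists F => // x /MN /NF. Qed.

Lemma nowhere_dense_meager F : nowhere_dense F -> meager F.
Proof. by move=> hF; exists (fun=> F) => // x Fx; exists 0. Qed.

Lemma nowhere_dense0 : nowhere_dense set0.
Proof. by move=> v; exists [::]; rewrite setI0. Qed.

Lemma meager_bigcup (T : countType) (D : set T) (M : T -> set cantor_space) :
  (forall t, D t -> meager (M t)) -> meager (\bigcup_(t in D) M t).
Proof.
move=> hM; have /choice[F hF] : forall t, exists F : nat -> set cantor_space,
    (forall n, nowhere_dense (F n)) /\ (D t -> M t `<=` \bigcup_n F n).
  move=> t; have [/hM[F h1 h2]|nD] := pselect (D t); first by exists F.
  by exists (fun=> set0); split=> // _; exact: nowhere_dense0.
exists (fun k => if @unpickle (T * nat)%type k is Some (t, n) then F t n else set0).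
  by move=> k; case: unpickle => [[t n]|]; [case: (hF t)|exact: nowhere_dense0].
move=> x [t Dt] /(proj2 (hF t) Dt)[n _ Fx]; exists (pickle (t, n)) => //.
by rewrite pickleK.
Qed.

Lemma meagerU (M N : set cantor_space) : meager M -> meager N -> meager (M `|` N).
Proof.
move=> hM hN; apply: (@sub_meager _ (\bigcup_(b : bool) (if b then M else N))).
  by move=> x [Mx|Nx]; [exists true|exists false].
by apply: meager_bigcup => -[] _.
Qed.

(** Padding [v] to length at least [k] leaves a word after its first [k] letters; extending that
    word to avoid [F] extends [v] as required. *)
Lemma nowhere_dense_shift k F : nowhere_dense F -> nowhere_dense (shift k @^-1` F).
Proof.
move=> hF v; pose a := v ++ nseq k false.
have [v' hv'] := hF (drop k a); exists (nseq k false ++ v').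
have ka : k <= size a by rewrite size_cat size_nseq leq_addl.
rewrite catA -/a -subset0 -{1}(cat_take_drop k a) -catA => y [/cyl_cat[_]].
rewrite size_takel// => h Fy; suff : set0 (shift k y) by [].
by rewrite -hv'.
Qed.

Lemma meager_shift k M : meager M -> meager (shift k @^-1` M).
Proof.
move=> [F hF MF]; exists (fun n => shift k @^-1` F n).
  by move=> n; exact: nowhere_dense_shift.
by move=> x /MF[n _ Fx]; exists n.
Qed.

Definition comeager_in w (C : set cantor_space) := meager (cyl w `\` C).

Lemma comeager_in_ext u v C : comeager_in u C -> comeager_in (u ++ v) C.
Proof. by apply: sub_meager => x [/cyl_catl ? ?]. Qed.

(** There are countably many cylinders, so [C] misses only a meager part of the union of those in
    which it is comeager. These are dense in [cyl w], so the rest of [cyl w] is nowhere dense. *)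
Lemma comeager_in_dense w C :
  (forall v, exists v', comeager_in (w ++ v ++ v') C) -> comeager_in w C.
Proof.
move=> h; pose D v := comeager_in v C.
apply: (@sub_meager _ ((\bigcup_(v in D) (cyl v `\` C)) `|`
    (cyl w `\` \bigcup_(v in D) cyl v))).
  move=> x [wx nCx]; have [[v Dv vx]|nx] := pselect ((\bigcup_(v in D) cyl v) x).
    by left; exists v.
  by right.
apply: meagerU; first exact: meager_bigcup.
apply: nowhere_dense_meager => v.
have [[t et]|nt] := pselect (exists t, v = w ++ t).
  have [v' Dv'] := h t; exists v'; rewrite -subset0 => y [vy [_]]; apply.
  by exists (v ++ v') => //; rewrite /D et -catA.
(* Otherwise [v] is incompatible with [w] or a prefix of it. *)
have [v' hv'] := h [::].
have [vw|wv] := leqP (size w) (size v).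
  exists [::]; rewrite cats0 -subset0 => y [vy [wy _]]; apply: nt.
  exists (drop (size w) v); rewrite -{1}(cat_take_drop (size w) v); congr (_ ++ _).
  move/cylP: vy => vy; rewrite -[RHS]wy; apply: (@eq_from_nth _ false).
    by rewrite size_mkseq size_takel.
  rewrite size_takel// => i iw.
  by rewrite nth_take// nth_mkseq// vy// (leq_trans iw).
(* The missing letters of [w] come first, so any point of [cyl w] in the new cylinder lies in
   [cyl (w ++ v')]. *)
exists (drop (size v) w ++ v'); rewrite -subset0 => y [vy [wy]]; apply.
exists (w ++ v') => //.
apply/cylP => j jn; rewrite size_cat in jn.
move/cyl_cat: vy => [vy /cyl_cat[_ vy2]].
rewrite nth_cat; case: ltnP => jw; first by move/cylP: wy; apply.
move/cylP: vy2 => /(_ (j - size w)).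
rewrite /shift size_drop addnA subnKC ?(ltnW wv)// subnKC// => -> //.
by rewrite ltn_subLR.
Qed.

(* The Baire property, in the localised form in which it is needed. *)
Definition decided (C : set cantor_space) :=
  forall w, exists v, comeager_in (w ++ v) C \/ comeager_in (w ++ v) (~` C).

Lemma decidedC C : decided C -> decided (~` C).
Proof. by move=> h w; have [v [H|H]] := h w; exists v; rewrite setCK; tauto. Qed.

Lemma comeager_in_cyl w C : cyl w `<=` C -> comeager_in w C.
Proof.
rewrite -setD_eq0 /comeager_in => ->.
exact/nowhere_dense_meager/nowhere_dense0.
Qed.

Lemma decided_open C : open C -> decided C.
Proof.
move=> oC w; have [[x [wx Cx]]|h] := pselect ((cyl w `&` C) !=set0).
  (* If [n <= size w], the added word is empty and [cyl w] already lies in [C]. *)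
  have [n nC] := open_cyl oC Cx; exists (drop (size w) (mkseq x n)); left.
  apply: comeager_in_cyl => y /cyl_cat[wy hy]; apply: nC; apply/mkseq_eqP => j jn.
  case: (ltnP j (size w)) => jw.
    by move/cylP: wy => -> //; move/cylP: wx => ->.
  move/cylP: hy => /(_ (j - size w)); rewrite size_drop size_mkseq /shift subnKC//.
  rewrite nth_drop subnKC// nth_mkseq// => -> //.
  by rewrite ltn_sub2r// (leq_ltn_trans jw).
exists [::]; right; rewrite cats0; apply: comeager_in_cyl => y wy Cy.
by apply: h; exists y.
Qed.

Lemma comeager_in_bigcap w (C : nat -> set cantor_space) :
  (forall n, comeager_in w (C n)) -> comeager_in w (\bigcap_n C n).
Proof.
move=> h; apply: sub_meager (meager_bigcup (D := setT) (fun n _ => h n)) => x [wx nCx].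
by apply: contrapT => nx; apply: nCx => n _;
   apply: contrapT => nCx; apply: nx; exists n.
Qed.

(** Either some [C n] is comeager in a cylinder inside [cyl w], or the complement of each [C n] is
    comeager in densely many of them, hence in [cyl w], and so is the intersection of these
    complements. *)
Lemma decided_bigcup (C : nat -> set cantor_space) :
  (forall n, decided (C n)) -> decided (\bigcup_n C n).
Proof.
move=> h w.
have [[n [v Hv]]|H] := pselect (exists n v, comeager_in (w ++ v) (C n)).
  exists v; left; apply: sub_meager Hv => x [? nC]; split=> // Cx; apply: nC.
  by exists n.
exists [::]; right; rewrite cats0 setC_bigcup; apply: comeager_in_bigcap => n.
apply: comeager_in_dense => v; have [v' [Hv|Hv]] := h n (w ++ v).
  by case: H; exists n, (v ++ v'); rewrite catA.
by exists v'; rewrite catA.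
Qed.

Lemma decided_borel (T : topologicalType) (B : set T) (h : cantor_space -> T) :
  continuous h -> borel B -> decided (h @^-1` B).
Proof.
(* The generated sigma-algebra is the least one containing the open sets, so it is compared with the
   class of sets whose preimage is decided. *)
move=> ch hB; apply: (hB [set A | decided (h @^-1` A)]); split; last first.
  by move=> U oU; apply: decided_open; exact: open_comp.
split=> [|A hA|A hA].
- by rewrite /= preimage_set0; apply: decided_open; exact: open0.
- by rewrite /= setTD preimage_setC; exact: decidedC.
- by rewrite /= preimage_bigcup; exact: decided_bigcup.
Qed.

(** * The words [s_ n] and the edges of [G0] *)

Lemma mem_words k w : (w \in words k) = (size w == k).
Proof.
elim: k w => [|k IH] [|b w]; rewrite ?mem_seq1//= mem_cat.
  by apply/negP => /orP[] /mapP[].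
rewrite eqSS -IH; apply/orP/idP => [[/mapP[w' h [_ ->]]|/mapP[w' h [_ ->]]]|h] //.
by case: b; [right|left]; rewrite map_f.
Qed.

Definition words_upto k := flatten [seq words j | j <- iota 0 k.+1].

Lemma words_uptoS k : words_upto k.+1 = words_upto k ++ words k.+1.
Proof.
by rewrite /words_upto -[in LHS]addn1 iotaD map_cat flatten_cat/= cats0.
Qed.

Lemma size_words_upto k : k < size (words_upto k).
Proof.
elim: k => // k IH; rewrite words_uptoS size_cat -addn1 leq_add//.
have : nseq k.+1 false \in words k.+1 by rewrite mem_words size_nseq.
by case: (words k.+1).
Qed.

Lemma nth_words_upto j k n : j <= k -> n < size (words_upto j) ->
  nth [::] (words_upto k) n = nth [::] (words_upto j) n.
Proof.
move=> jk nj; rewrite -(subnKC jk); elim: (k - j) => [|d IH]; first by rewrite addn0.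
have le d' : size (words_upto j) <= size (words_upto (j + d')).
  elim: d' => [|d' IH']; first by rewrite addn0.
  by rewrite addnS words_uptoS size_cat (leq_trans IH') ?leq_addr.
by rewrite addnS words_uptoS nth_cat (leq_trans nj (le d)).
Qed.

Lemma size_psi n : size (psi n) <= n.
Proof.
have : psi n \in words_upto n by apply/mem_nth/size_words_upto.
move=> /flattenP[s /mapP[j + ->]]; rewrite mem_iota mem_words => jn /eqP ->.
by rewrite -ltnS.
Qed.

(** The lists [words_upto k] are prefixes of one another, so the index of [u] in one of them also
    finds [u] in the list that [psi] reads. *)
Lemma psi_surj u : exists n, psi n = u.
Proof.
have uk : u \in words_upto (size u).
  apply/flattenP; exists (words (size u)); last by rewrite mem_words.
  by apply: map_f; rewrite mem_iota /=.
exists (index u (words_upto (size u))).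
set n := index _ _; rewrite /psi -/(words_upto n).
have nu : n < size (words_upto (size u)) by rewrite index_mem.
rewrite -(@nth_words_upto n (maxn n (size u)) n) ?leq_maxl ?size_words_upto//.
by rewrite (@nth_words_upto (size u)) ?leq_maxr// nth_index.
Qed.

Lemma size_s n : size (s_ n) = n.
Proof. by rewrite size_cat size_nseq subnKC ?size_psi. Qed.

Lemma s_dense u : exists m v, s_ m = u ++ v.
Proof. by have [m e] := psi_surj u; exists m; rewrite /s_ e; eexists. Qed.

(** For [b = false] these are the pairs of [G0] based at [s_ n], for [b = true] their reversals; the
    coordinatewise form treats both orientations alike. *)
Definition edge (b : bool) n x y :=
  [/\ cyl (s_ n) x, x n = b, y n = ~~ b & forall i, i <> n -> x i = y i].

Lemma edge_sym b n x y : edge b n x y -> edge (~~ b) n y x.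
Proof.
move=> [sx xn yn h]; split; rewrite ?negbK//; last first.
  by move=> i /h.
apply/cylP => i; rewrite size_s => i_n; rewrite -h; last first.
  by move=> e; rewrite e ltnn in i_n.
by move/cylP: sx; apply; rewrite size_s.
Qed.

Lemma edge_wcat x y n : edge false n x y -> exists z,
  x = wcat (rcons (s_ n) false) z /\ y = wcat (rcons (s_ n) true) z.
Proof.
move=> exy; have [sx xn yn h] := exy.
have cylx : cyl (rcons (s_ n) false) x.
  rewrite -cats1; apply/cyl_cat; split=> //; apply/cylP => -[|//] _.
  by rewrite /shift addn0 size_s.
have cyly : cyl (rcons (s_ n) true) y.
  have [sy _ _ _] := edge_sym exy.
  rewrite -cats1; apply/cyl_cat; split=> //; apply/cylP => -[|//] _.
  by rewrite /shift addn0 size_s.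
exists (shift n.+1 x); split.
  by rewrite -[in LHS](wcat_shift cylx) size_rcons size_s.
rewrite -[in LHS](wcat_shift cyly) size_rcons size_s; congr wcat.
apply/funext => i; rewrite /shift h// => e.
by have := ltnn n; rewrite -{2}e addSn ltnS leq_addr.
Qed.

Lemma G0P x y : G0 (x, y) <-> exists n, edge false n x y.
Proof.
split=> [[n [z [-> ->]]]|[n /edge_wcat[z [-> ->]]]]; last by exists n, z.
have sz c : size (rcons (s_ n) c) = n.+1 by rewrite size_rcons size_s.
have nthc c : wcat (rcons (s_ n) c) z n = c.
  by rewrite wcat_lt ?sz// nth_rcons size_s ltnn eqxx.
exists n; split=> //.
  by have := @cyl_wcat (rcons (s_ n) false) z; rewrite -cats1 => /cyl_cat[].
move=> i /eqP; rewrite neq_ltn => /orP[i_n|n_i].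
  by rewrite !wcat_lt ?sz ?(leqW i_n)// !nth_rcons size_s i_n.
rewrite -(subnKC n_i) -[in LHS](sz false) -[in RHS](sz true).
by rewrite !wcat_ge !sz.
Qed.

(** * Generic colourings and a frequent colour *)

Definition generic (C : Type) (f : cantor_space -> C) :=
  forall w, exists v c, comeager_in (w ++ v) (f @^-1` [set c]).

Lemma comeager_inI w (C D : set cantor_space) :
  comeager_in w C -> comeager_in w D -> comeager_in w (C `&` D).
Proof.
move=> hC hD; apply: sub_meager (meagerU hC hD) => x [wx nx].
by apply: contrapT => nn; apply: nx; split;
   apply: contrapT => n; apply: nn; [left|right].
Qed.

Lemma sub_comeager_in w (C D : set cantor_space) :
  C `<=` D -> comeager_in w C -> comeager_in w D.
Proof. by move=> CD; apply: sub_meager => x [wx nD]; split=> // /CD. Qed.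

Lemma generic_pair (C D : Type) (f : cantor_space -> C) (g : cantor_space -> D) :
  generic f -> generic g -> generic (fun x => (f x, g x)).
Proof.
move=> hf hg w; have [v [c hc]] := hf w; have [v' [d hd]] := hg (w ++ v).
exists (v ++ v'), (c, d); rewrite catA.
apply: sub_comeager_in (comeager_inI (comeager_in_ext v' hc) hd).
by move=> x [/= -> ->].
Qed.

Lemma generic_decided (C : set cantor_space) :
  decided C -> generic (fun x => `[< C x >]).
Proof.
move=> hC w; have [v [H|H]] := hC w; exists v; [exists true|exists false];
  apply: sub_comeager_in H => x Cx /=; [exact: asboolT|exact: asboolF].
Qed.

(** Otherwise the finitely many colours can be excluded one by one along longer and longer words
    [t]. Past the last one, some [s_ m] extends [t], and genericity of [col m] yields a colour that
    was excluded. *)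
Lemma frequent_color (C : finType) (col : nat -> cantor_space -> C) :
  (forall m, generic (col m)) ->
  exists c t, forall t', exists v u, let m := size (t ++ t' ++ v) in
    s_ m = t ++ t' ++ v /\ comeager_in u (col m @^-1` [set c]).
Proof.
move=> gen; apply: contrapT => hn.
suff [t ht] : exists t, forall c, c \in enum C -> forall v u,
    let m := size (t ++ v) in s_ m = t ++ v ->
    ~ comeager_in u (col m @^-1` [set c]).
  have [m [v sv]] := s_dense t; have [u [c hc]] := gen m [::].
  apply: (ht c _ v u); rewrite ?mem_enum// -sv size_s//.
elim: (enum C) => [|c cs [t IH]]; first by exists [::].
have [t' ht'] : exists t', forall v u, let m := size (t ++ t' ++ v) in
    s_ m = t ++ t' ++ v -> ~ comeager_in u (col m @^-1` [set c]).
  apply: contrapT => hn'; apply: hn; exists c, t => t'.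
  apply: contrapT => hn''; apply: hn'; exists t' => v u m sm hu.
  by apply: hn''; exists v, u.
exists (t ++ t') => c'; rewrite inE => /predU1P[->|c'cs] v u; rewrite -catA.
  exact: ht'.
exact: IH.
Qed.

(** * The fusion map *)

Lemma nowhere_dense_seq (l : seq (seq bool)) F : nowhere_dense F ->
  exists v, forall w, w \in l -> cyl (w ++ v) `&` F = set0.
Proof.
move=> hF; elim: l => [|w l [v IH]]; first by exists [::].
have [v' hv'] := hF (w ++ v); exists (v ++ v') => w'.
rewrite inE => /predU1P[->|/IH h]; rewrite catA// -subset0 => x [/cyl_catl hx Fx].
by rewrite -h.
Qed.

Section approximation.
Variables (b : bool) (t : seq bool) (pq : nat -> seq bool * seq bool).

Fixpoint approx n x : seq bool :=
  if n is n'.+1 then approx n' x ++ (pq n').1 ++ (x n' (+) b) :: (pq n').2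
  else t.

Definition zeros : cantor_space := fun=> false.

(** The position of the bit [x n] in the limit; it is the same for all [x], so it is computed at
    [zeros]. *)
Definition kpos n := size (approx n zeros ++ (pq n).1).

(** Stage [i.+1] has length at least [i.+1], and later stages extend it, so the default value is
    never read. *)
Definition approx_lim x : cantor_space := fun i => nth false (approx i.+1 x) i.

Lemma size_approx n x y : size (approx n x) = size (approx n y).
Proof. by elim: n => //= n IH; rewrite !size_cat IH /=. Qed.

Lemma leq_size_approx n x : n <= size (approx n x).
Proof.
elim: n => //= n IH.
by rewrite size_cat -addn1 leq_add// size_cat /= addnS.
Qed.

Lemma size_approxp n x : size (approx n x ++ (pq n).1) = kpos n.
Proof. by rewrite /kpos !size_cat (size_approx n x zeros). Qed.

Lemma leq_kpos n : n <= kpos n.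
Proof. by rewrite /kpos size_cat (leq_trans (leq_size_approx n zeros)) ?leq_addr. Qed.

Lemma nth_approx m n x i : m <= n -> i < size (approx m x) ->
  nth false (approx n x) i = nth false (approx m x) i.
Proof.
move=> mn im; rewrite -(subnKC mn); elim: (n - m) => [|d IH]; first by rewrite addn0.
have le d' : size (approx m x) <= size (approx (m + d') x).
  elim: d' => [|d' IH']; first by rewrite addn0.
  by rewrite addnS/= size_cat (leq_trans IH') ?leq_addr.
by rewrite addnS/= nth_cat (leq_trans im (le d)).
Qed.

Lemma cyl_approx n x : cyl (approx n x) (approx_lim x).
Proof.
apply/cylP => i i_n; rewrite /approx_lim.
rewrite -(@nth_approx i.+1 (maxn n i.+1)) ?leq_maxr ?leq_size_approx//.
by rewrite (@nth_approx n) ?leq_maxl.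
Qed.

Lemma approx_lim_spec n x : [/\ cyl (approx n x ++ (pq n).1) (approx_lim x),
  approx_lim x (kpos n) = x n (+) b & cyl (pq n).2 (shift (kpos n).+1 (approx_lim x))].
Proof.
have := cyl_approx n.+1 x; rewrite /= -cat1s !catA.
move=> /cyl_cat[/cyl_cat[h1 h2] h3]; split=> //.
  by move/cylP: h2 => /(_ 0 isT); rewrite /shift addn0 size_approxp.
by move: h3; rewrite size_cat size_approxp addn1.
Qed.

Lemma kpos_mono m n : m < n -> kpos m < kpos n.
Proof.
elim: n => // n IH; rewrite ltnS leq_eqVlt => mn.
suff : kpos n < kpos n.+1 by case/predU1P: mn => [->|/IH h]//; exact: ltn_trans.
by rewrite /kpos /= !size_cat /= -!addnA ltn_add2l -[ltnLHS]addn0 ltn_add2l addSn.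
Qed.

Lemma kpos_inj : injective kpos.
Proof.
move=> m n e; apply/eqP; apply: contraT; rewrite neq_ltn.
by move=> /orP[] /kpos_mono; rewrite e ltnn.
Qed.

Lemma approx_lim_eq x y i : (forall j, kpos j = i -> x j = y j) ->
  approx_lim x i = approx_lim y i.
Proof.
move=> h; rewrite /approx_lim; elim: i.+1 => //= n IH.
rewrite !nth_cat (size_approx n y x); case: ltnP => // h1.
case: ltnP => // h2; case e : (_ - _) => //=; congr (_ (+) _); apply: h.
(* The index falls on the free bit of block [n], which means that [i] is [kpos n]. *)
rewrite -(size_approxp n x) size_cat; apply/eqP.
by rewrite eqn_leq -leq_subRL ?h1// h2/= -leq_subLR -subn_eq0 e.
Qed.

Lemma approx_lim_inj : injective approx_lim.
Proof.
move=> x y e; apply/funext => n; apply: (@addIb b).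
by have [_ <- _] := approx_lim_spec n x;
   have [_ <- _] := approx_lim_spec n y; rewrite e.
Qed.

Lemma continuous_approx_lim : continuous approx_lim.
Proof.
apply: continuous_cantor => x i; exists i.+1 => z /mkseq_eqP h.
by apply: approx_lim_eq => j e; apply: h; rewrite ltnS -e leq_kpos.
Qed.

(** As [approx n] reads only the first [n] bits, [zeros] stands for an arbitrary tail. The words
    [(pq n).1] are chosen so that the branch [s_ n] is sent to a base word of [G0]. *)
Hypothesis kpos_s : forall n, approx n (wcat (s_ n) zeros) ++ (pq n).1 = s_ (kpos n).

Lemma cyl_kpos n x : cyl (s_ n) x <-> cyl (s_ (kpos n)) (approx_lim x).
Proof.
set x0 := wcat (s_ n) zeros.
have sx0 : cyl (s_ n) x0 by exact: cyl_wcat.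
have [h0 _ _] := approx_lim_spec n x0; rewrite kpos_s in h0.
move/cylP: sx0; move/cylP: h0; rewrite !size_s => h0 sx0.
split=> /cylP; rewrite size_s => h; apply/cylP => j; rewrite size_s => jn.
  rewrite -h0//; apply: approx_lim_eq => k e.
  (* Before position [kpos n] the limit depends only on the first [n] bits of its argument. *)
  suff kn : k < n by rewrite h ?sx0.
  rewrite ltnNge leq_eqVlt; apply/negP.
  by move=> /predU1P[nk|/kpos_mono nk]; move: jn; rewrite -e ?nk ?ltnn// ltnNge ltnW.
(* Conversely, bit [j] is recovered from position [kpos j], which precedes [kpos n]. *)
rewrite -sx0//; apply: (@addIb b).
by have [_ <- _] := approx_lim_spec j x; have [_ <- _] := approx_lim_spec j x0;
  rewrite h ?h0// kpos_mono.
Qed.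

Lemma edge_approx_lim c n x y : edge c n x y ->
  edge (c (+) b) (kpos n) (approx_lim x) (approx_lim y).
Proof.
move=> [/cyl_kpos sx xn yn h]; split=> //.
- by have [_ -> _] := approx_lim_spec n x; rewrite xn.
- by have [_ -> _] := approx_lim_spec n y; rewrite yn addNb.
- by move=> i ik; apply: approx_lim_eq => j e; apply: h => jn; apply: ik; rewrite -e jn.
Qed.

(** Each bit where [x] and [y] differ shows up in the images at its [kpos], which must be [m]; since
    [kpos] is injective, there is exactly one such bit. *)
Lemma approx_lim_edge c m x y : edge c m (approx_lim x) (approx_lim y) ->
  exists2 n, m = kpos n & edge (c (+) b) n x y.
Proof.
move=> [sx xm ym h].
have [n nxy] : exists n, x n <> y n.
  apply: contrapT => hn; have e : x = y.
    by apply/funext => n; apply: contrapT => nxy; apply: hn; exists n.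
  by move: ym; rewrite -e xm; case: (c).
have key k : x k <> y k -> kpos k = m.
  move=> kxy; apply: contrapT => km; apply: kxy; apply: (@addIb b).
  by have [_ <- _] := approx_lim_spec k x;
     have [_ <- _] := approx_lim_spec k y; exact: h.
have en := key _ nxy; exists n => //; subst m; split; first exact: (cyl_kpos n x).2.
- by have [_ + _] := approx_lim_spec n x; rewrite xm => ->; rewrite -addbA addbb addbF.
- by have [_ + _] := approx_lim_spec n y; rewrite ym -addNb => ->;
   rewrite -addbA addbb addbF.
- by move=> i i_n; apply: contrapT => /key /kpos_inj.
Qed.

(** For [b = true] the free bits are complemented, which reverses every edge. *)
Lemma G0_approx_lim x y :
  G0 (approx_lim x, approx_lim y) <-> G0 (if b then (y, x) else (x, y)).
Proof.
have -> : G0 (if b then (y, x) else (x, y)) <-> exists n, edge b n x y.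
  case: b; last exact: G0P.
  by rewrite G0P; split=> -[n /edge_sym h]; exists n.
rewrite G0P; split=> [[m /approx_lim_edge[n _ h]]|[n /edge_approx_lim h]].
  by exists n; rewrite addFb in h.
by exists (kpos n); rewrite addbb in h.
Qed.

End approximation.

(** Each stage takes finitely many values, so a single word moves all of them away from [F n]; the
    requirement [R] concerns only the branch [s_ n] and is met by extending that word further. *)
Lemma fusion b t (F : nat -> set cantor_space) (R : seq bool -> seq bool -> Prop) :
  (forall n, nowhere_dense (F n)) ->
  (forall t', exists v u, R (t ++ t' ++ v) u) ->
  exists pq, forall n,
    (forall x, ~ F n (approx_lim b t pq x)) /\
    R (approx b t pq n (wcat (s_ n) zeros) ++ (pq n).1) (pq n).2.
Proof.
move=> hF hR.
pose small (S : cantor_space -> seq bool) :=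
  (exists l : seq (seq bool), forall x, S x \in l) /\
  (forall x, exists t', S x = t ++ t').
(* Stated for arbitrary [S], with a dummy answer when [S] is not small, so that [choice] gives a
   total function. *)
have step (nS : nat * (cantor_space -> seq bool)) : exists pq, small nS.2 ->
    (forall x, cyl (nS.2 x ++ pq.1) `&` F nS.1 = set0) /\
    R (nS.2 (wcat (s_ nS.1) zeros) ++ pq.1) pq.2.
  case: nS => n S /=; have [[[l hl] hS]|] := pselect (small S);
    last by exists ([::], [::]).
  have [v hv] := nowhere_dense_seq l (hF n).
  have [t' et'] := hS (wcat (s_ n) zeros).
  have [v' [u hu]] := hR (t' ++ v).
  (* Avoidance comes first because it survives extension, while [R] is guaranteed only for the final
     word. *)
  exists (v ++ v', u) => _ /=; split; last by rewrite et' -catA (catA t').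
  move=> x; rewrite catA -subset0 => y [/cyl_catl Sy Fy].
  by rewrite -(hv _ (hl x)).
have [G hG] := choice step.
(* The next words depend on the whole stage map, so the recursion produces these maps; [StE] then
   identifies them with [approx]. *)
pose fix St n : cantor_space -> seq bool := if n is n'.+1 then fun x =>
  St n' x ++ (G (n', St n')).1 ++ (x n' (+) b) :: (G (n', St n')).2 else fun=> t.
pose pq n := G (n, St n); exists pq.
have StE n : St n = approx b t pq n.
  by elim: n => //= n IH; apply/funext => x; rewrite -IH.
have smallSt n : small (St n).
  elim: n => [|n [[l IH1] IH2]].
    by split=> [|x]; [exists [:: t] => x; rewrite inE|exists [::]; rewrite cats0].
  split; last first.
    by move=> x; have [t' e] := IH2 x; rewrite /= e -catA; eexists.
  exists [seq w ++ (pq n).1 ++ e :: (pq n).2 | w <- l, e <- [:: false; true]] => x.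
  apply/allpairsP; exists (St n x, x n (+) b); split=> //=.
  by case: (_ (+) _).
move=> n; have [/= h1 h2] := hG (n, St n) (smallSt n).
rewrite StE in h1 h2; rewrite /pq StE; split=> // x Fx.
suff : (set0 : set cantor_space) (approx_lim b t pq x) by [].
rewrite -(h1 x); split=> //.
by have [] := approx_lim_spec b t pq n x; rewrite /pq StE.
Qed.

(** * Colours *)

Definition cons_seq (e : bool) x : cantor_space := wcat [:: e] x.

Lemma cons_seq_shift x : cons_seq (x 0) (shift 1 x) = x.
Proof. by apply: (@wcat_shift [:: x 0]); apply/cylP => -[]. Qed.

Lemma cons_seq_inj d e x y : cons_seq d x = cons_seq e y -> d = e /\ x = y.
Proof.
move=> h; split; first by have := congr1 (fun f => f 0) h.
by rewrite -(shift_wcat [:: d] x) -(shift_wcat [:: e] y) -!/(cons_seq _ _) h.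
Qed.

(** Each inner pair records a pair of points and its reversal, so [s(B) = s(T0)] amounts to a true
    entry in both. *)
Definition color := (bool * bool * (bool * bool))%type.

Definition edge_color (B : set (cantor_space * cantor_space)) x y : color :=
  (`[< B (cons_seq false x, cons_seq true y) >],
   `[< B (cons_seq true y, cons_seq false x) >],
   (`[< B (cons_seq true x, cons_seq false y) >],
    `[< B (cons_seq false y, cons_seq true x) >])).

Definition color_rel (d : color) : set (cantor_space * cantor_space) :=
  [set p | exists x y, G0 (x, y) /\
    let: (d1, d2, (d3, d4)) := d in
    [\/ d1 /\ p = (cons_seq false x, cons_seq true y),
        d2 /\ p = (cons_seq true y, cons_seq false x),
        d3 /\ p = (cons_seq true x, cons_seq false y) |
        d4 /\ p = (cons_seq false y, cons_seq true x)]].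

Lemma color_rel_G : color_rel (true, false, (false, true)) = G_s_G0.
Proof.
apply/seteqP; split=> p.
  move=> [x [y [xy [[_ ->]|[]//|[]//|[_ ->]]]]].
    by exists x, y; split=> //; left.
  by exists y, x; split=> //; right.
move=> [x [y [[xy|xy] ->]]].
  by exists x, y; split=> //; constructor 1.
by exists y, x; split=> //; constructor 4.
Qed.

Lemma color_rel_T : color_rel (true, false, (true, false)) = T0.
Proof.
apply/seteqP; split=> p.
  move=> [x [y [xy [[_ ->]|[]//|[_ ->]|[]//]]]].
    by exists false, x, y.
  by exists true, x, y.
move=> [[] [x [y [xy ->]]]]; exists x, y; split=> //.
  by constructor 3.
by constructor 1.
Qed.

Lemma color_rel_U : color_rel (true, false, (true, true)) = U0.
Proof.
rewrite /U0 -color_rel_G -color_rel_T; apply/seteqP; split=> p.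
  move=> [x [y [xy [h|[]//|h|h]]]].
  - by left; exists x, y; split=> //; constructor 1.
  - by right; exists x, y; split=> //; constructor 3.
  - by left; exists x, y; split=> //; constructor 4.
by move=> [] [x [y [xy [h|[]//|h|h]]]]; exists x, y; split=> //;
  move: h => [] // _ h; [constructor 1|constructor 4|constructor 1|constructor 3].
Qed.

Lemma color_rel_sT : color_rel (true, true, (true, true)) = symmetrization T0.
Proof.
rewrite -color_rel_T; apply/seteqP; split=> -[p1 p2].
  move=> [x [y [xy [[_ h]|[_ [-> ->]]|[_ h]|[_ [-> ->]]]]]].
  - by left; exists x, y; split=> //; constructor 1.
  - by right; exists x, y; split=> //; constructor 1.
  - by left; exists x, y; split=> //; constructor 3.
  - by right; exists x, y; split=> //; constructor 3.
move=> [] [x [y [xy [[_ [e1 e2]]|[]//|[_ [e1 e2]]|[]//]]]];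
  exists x, y; split=> //; move: e1 e2 => /= -> ->.
- by constructor 1.
- by constructor 3.
- by constructor 2.
- by constructor 4.
Qed.

(** With [x] and [y] exchanged, (0x,1y) becomes (0y,1x) and (1y,0x) becomes (1x,0y): the entries are
    read in reverse order. *)
Definition flip_color (b : bool) (c : color) : color :=
  let: (c1, c2, (c3, c4)) := c in
  if b then (c4, c3, (c2, c1)) else c.

Definition swap_color (e : bool) (c : color) : color :=
  if e then (c.2, c.1) else c.

(** Three values remain for each inner pair; for each of the nine colours one of the four choices of
    [b] and [e] works by computation. *)
Lemma color_normal (c : color) : c.1.1 || c.1.2 -> c.2.1 || c.2.2 ->
  exists b e, let d := swap_color e (flip_color b c) in
    [\/ d = (true, false, (false, true)), d = (true, false, (true, false)),
        d = (true, false, (true, true)) | d = (true, true, (true, true))].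
Proof.
have case b e : let d := swap_color e (flip_color b c) in
    [|| d == (true, false, (false, true)), d == (true, false, (true, false)),
        d == (true, false, (true, true)) | d == (true, true, (true, true))] ->
    exists b e, let d := swap_color e (flip_color b c) in
    [\/ d = (true, false, (false, true)), d = (true, false, (true, false)),
        d = (true, false, (true, true)) | d = (true, true, (true, true))].
  move=> d /or4P h; exists b, e; rewrite -/d.
  by case: h => /eqP; [constructor 1|constructor 2|constructor 3|constructor 4].
move: case; case: c => [[[] []] [[] []]] case //= _ _;
  by [exact: (case false false)|exact: (case false true)|
      exact: (case true false)|exact: (case true true)].
Qed.

Lemma color_rel_sub d x y e e' :
  color_rel d (cons_seq e x, cons_seq e' y) -> symmetrization G0 (x, y) /\ e' = ~~ e.
Proof.
case: d => [[d1 d2] [d3 d4]] [x' [y' [xy]]].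
by case=> -[_ [/cons_seq_inj[-> ->] /cons_seq_inj[-> ->]]]; split=> //; by [left|right].
Qed.

(** * From monochromatic embeddings to reductions *)

Section reduction.
Variables (B : set (cantor_space * cantor_space)).
Hypothesis BT : B `<=` symmetrization T0.

(** The reduction applies [f] behind the first letter and adds [e] to that letter; reversing edges
    and exchanging the copies act on colours as [flip_color] and [swap_color]. *)
Lemma cont_reducible_color (f : cantor_space -> cantor_space) b e c :
  injective f -> continuous f ->
  (forall x y, G0 (f x, f y) <-> G0 (if b then (y, x) else (x, y))) ->
  (forall x y, G0 (f x, f y) -> edge_color B (f x) (f y) = c) ->
  cont_reducible (color_rel (swap_color e (flip_color b c))) B.
Proof.
move=> finj fcont fG fc.
pose F x := cons_seq (x 0 (+) e) (f (shift 1 x)).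
have sG x y : symmetrization G0 (f x, f y) <-> symmetrization G0 (x, y).
  by rewrite /symmetrization /setU /= !fG; case: (b); tauto.
have key x y : G0 (x, y) ->
    (`[< B (cons_seq (false (+) e) (f x), cons_seq (true (+) e) (f y)) >],
     `[< B (cons_seq (true (+) e) (f y), cons_seq (false (+) e) (f x)) >],
     (`[< B (cons_seq (true (+) e) (f x), cons_seq (false (+) e) (f y)) >],
      `[< B (cons_seq (false (+) e) (f y), cons_seq (true (+) e) (f x)) >])) =
    swap_color e (flip_color b c).
  move=> xy; case: (boolP b) => hb.
    have h : G0 (f y, f x) by rewrite fG hb.
    by rewrite -(fc _ _ h); case: (e).
  have h : G0 (f x, f y) by rewrite fG (negbTE hb).
  by rewrite -(fc _ _ h); case: (e).
exists F; split.
- move=> x y /cons_seq_inj[/addIb e0 /finj e1].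
  by rewrite -(cons_seq_shift x) e0 e1 cons_seq_shift.
- apply: continuous_cantor => x [|i].
    by exists 1 => z /mkseq_eqP h; rewrite /F /cons_seq /wcat /= h.
  have : nbhs x [set z | f (shift 1 z) i = f (shift 1 x) i].
    have sc : continuous (shift 1).
      by apply: continuous_cantor => u j; exists j.+2 => z /mkseq_eqP; exact.
    have := @continuous_comp _ _ _ _ f x (sc x) (fcont _).
    move=> /(_ [set z | z i = f (shift 1 x) i]); apply.
    have := @nbhs_mkseq (f (shift 1 x)) i.+1; apply: filterS => z /mkseq_eqP; exact.
  rewrite nbhsE => -[U [oU Ux] hU]; have [n hn] := open_cyl oU Ux.
  by exists n => z /hn/hU /=; rewrite /F /cons_seq /wcat /= subn1 !nth_nil.
have E1 d (u : cantor_space) : F (cons_seq d u) = cons_seq (d (+) e) (f u).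
  by rewrite /F (shift_wcat [:: d]).
move=> x y; rewrite -(cons_seq_shift x) -(cons_seq_shift y).
move: (x 0) (y 0) (shift 1 x) (shift 1 y) => d d' u v; rewrite !E1.
case: (swap_color _ _) key => [[d1 d2] [d3 d4]] key.
split=> [h|[x' [y' [xy]]]].
  (* By [BT] a pair of [B] lies over an edge, in one direction or the other, and joins the two
     copies. *)
  have [] : symmetrization G0 (f u, f v) /\ d' (+) e = ~~ (d (+) e).
    apply: (@color_rel_sub (true, true, (true, true))).
    by rewrite color_rel_sT; exact: BT.
  rewrite sG -addNb => uv /addIb ed; subst d'.
  case: uv => [uv|vu].
    have [e1 _ e3 _] := key _ _ uv; exists u, v; split=> //.
    case: d h => h; [constructor 3|constructor 1]; split=> //.
      by rewrite -e3; exact: asboolT.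
    by rewrite -e1; exact: asboolT.
  have [_ e2 _ e4] := key _ _ vu; exists v, u; split=> //.
  case: d h => h; [constructor 2|constructor 4]; split=> //.
    by rewrite -e2; exact: asboolT.
  by rewrite -e4; exact: asboolT.
have [e1 e2 e3 e4] := key _ _ xy.
by case=> -[dT [/cons_seq_inj[-> ->] /cons_seq_inj[-> ->]]]; apply/asboolP;
  rewrite ?e1 ?e2 ?e3 ?e4.
Qed.

End reduction.

(** * The monochromatic embedding and the conclusion *)

Lemma exists_G0 : exists p, G0 p.
Proof. by eexists; exists 0, zeros. Qed.

(** The colour is fixed before [b], so that the orientation can later be chosen according to [c]. *)
Lemma monochromatic_embedding B : borel B -> exists c, forall b,
  exists f : cantor_space -> cantor_space, [/\ injective f, continuous f,
    forall x y, G0 (f x, f y) <-> G0 (if b then (y, x) else (x, y)) &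
    forall x y, G0 (f x, f y) -> edge_color B (f x) (f y) = c].
Proof.
move=> hB.
pose col m z := edge_color B (wcat (rcons (s_ m) false) z) (wcat (rcons (s_ m) true) z).
have gen m : generic (col m).
  (* Each pair of points depends continuously on the common tail [z], so the Baire property of [B]
     passes to the colouring. *)
  have genB d d' w w' :
      generic (fun z => `[< B (cons_seq d (wcat w z), cons_seq d' (wcat w' z)) >]).
    have cw k v : continuous (fun z => cons_seq k (wcat v z)).
      rewrite (_ : (fun z => _) = wcat (k :: v)); first exact: continuous_wcat.
      by apply/funext => z; rewrite wcat_cons.
    apply: generic_decided.
    apply: (@decided_borel _ B
      (fun z => (cons_seq d (wcat w z), cons_seq d' (wcat w' z))) _ hB).
    move=> z; exact: (cvg_pair (cw d w z) (cw d' w' z)).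
  by apply: (generic_pair (generic_pair _ _) (generic_pair _ _)); exact: genB.
have [c [t hct]] := frequent_color gen; exists c => b.
pose ok m := col m @^-1` [set c].
(* Some tail lies in a cylinder where [ok m] is comeager, yet outside [ok m]. There are countably
   many [m] and [u], so this set is meager and fusion can avoid it. *)
pose bad : set cantor_space := \bigcup_m (shift m.+1 @^-1`
    (\bigcup_(u in [set u | comeager_in u (ok m)]) (cyl u `\` ok m))).
have [F hF badF] : meager bad.
  by apply: meager_bigcup => m _; apply: meager_shift; apply: meager_bigcup.
pose R w u := s_ (size w) = w /\ comeager_in u (ok (size w)).
have [|pq hpq] := @fusion b t F R hF; first exact: hct.
have ks n : approx b t pq n (wcat (s_ n) zeros) ++ (pq n).1 = s_ (kpos b t pq n).
  by have [_ [<- _]] := hpq n; rewrite size_approxp.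
exists (approx_lim b t pq); split.
- exact: approx_lim_inj.
- exact: continuous_approx_lim.
- by move=> x y; exact: G0_approx_lim.
- move=> x y /G0P[m h]; have [n mE _] := approx_lim_edge ks h.
  have [_ [_ ok_n]] := hpq n; rewrite size_approxp -mE in ok_n.
  have [_ _ qx] := approx_lim_spec b t pq n x; rewrite -mE in qx.
  (* The tail after position [m] starts with [(pq n).2], in whose cylinder [ok m] is comeager;
     leaving [ok m] would make the point bad. *)
  have okx : ok m (shift m.+1 (approx_lim b t pq x)).
    apply: contrapT => nok.
    have /badF[k _ Fk] : bad (approx_lim b t pq x).
      by exists m => //; exists (pq n).2.
    by have [/(_ x)] := hpq k.
  have [z [ex ey]] := edge_wcat h.
  have := shift_wcat (rcons (s_ m) false) z; rewrite size_rcons size_s -ex => ez.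
  by rewrite -okx ez ex ey.
Qed.

Theorem theorem7p10 (B : set (cantor_space * cantor_space)) :
  borel B ->
  symmetrization B = symmetrization T0 ->
  exists A : set (cantor_space * cantor_space),
    [\/ A = G_s_G0, A = T0, A = U0 | A = symmetrization T0] /\
    cont_reducible A B.
Proof.
move=> hB BT.
have subB : B `<=` symmetrization T0 by rewrite -BT => p; left.
have TB p : T0 p -> B p \/ B (p.2, p.1).
  by move=> Tp; suff : symmetrization B p by []; rewrite BT; left.
have [c hc] := monochromatic_embedding hB.
(* The colour is realised by the image of an actual edge; the two pairs of [T0] over that image lie
   in [B] up to reversal. *)
have [c1 c2] : c.1.1 || c.1.2 /\ c.2.1 || c.2.2.
  have [f [_ _ fG fc]] := hc false; have [[x y] xy] := exists_G0.
  have fxy : G0 (f x, f y) by exact/fG.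
  rewrite -(fc _ _ fxy); split; apply/orP.
    have [|?|?] := TB (cons_seq false (f x), cons_seq true (f y)).
    - by exists false, (f x), (f y).
    - by left; exact/asboolP.
    - by right; exact/asboolP.
  have [|?|?] := TB (cons_seq true (f x), cons_seq false (f y)).
  - by exists true, (f x), (f y).
  - by left; exact/asboolP.
  - by right; exact/asboolP.
have [b [e d4]] := color_normal c1 c2.
have [f [finj fcont fG fc]] := hc b.
exists (color_rel (swap_color e (flip_color b c))); split; last first.
  exact: cont_reducible_color fG fc.
move: d4 => /= [] ->.
- by constructor 1; exact: color_rel_G.
- by constructor 2; exact: color_rel_T.
- by constructor 3; exact: color_rel_U.
- by constructor 4; exact: color_rel_sT.
Qed.
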